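(* Let $(X,d)$ be a complete metric space and $f:X\times X\to\mathcal{I}$ an interval-valued bifunction, $f(x,y)=[\underline{f}(x,y),\overline{f}(x,y)]$. Assume that (i) for each $x\in X$, $f(x,\cdot)$ is $\preccurlyeq$-lower semicontinuous and $\preccurlyeq$-lower bounded on $X$; (ii) for all $x,y,z\in X$, $f(x,z)\preccurlyeq f(x,y)+f(y,z)$. Then for every $\varepsilon>0$ and every $x_0\in X$ there exists $\overline{x}\in X$ such that (a) $f(x_0,\overline{x})\preccurlyeq f(x_0,x_0)$; (b) for all $x\in X$ with $x\ne\overline{x}$, $f(\overline{x},x)+[\varepsilon d(x,\overline{x}),\varepsilon d(x,\overline{x})]\not\preccurlyeq[0,0]$.
   Context: $\mathcal{I}=\{[a,b]:a\le b,\ a,b\in\mathbb{R}\}$ is the set of closed bounded real intervals, with addition $[\underline{a},\overline{a}]+[\underline{b},\overline{b}]=[\underline{a}+\underline{b},\overline{a}+\overline{b}]$. $[\underline{a},\overline{a}]\preccurlyeq[\underline{b},\overline{b}]$ means $\underline{a}\le\underline{b}$ and $\overline{a}\le\overline{b}$; $\not\preccurlyeq$ is its negation. An interval-valued function $g:X\to\mathcal{I}$ is $\preccurlyeq$-lower semicontinuous on $X$ if for every $A\in\mathcal{I}$ the set $\{x\in X:g(x)\preccurlyeq A\}$ is closed, and $\preccurlyeq$-lower bounded if there is $A\in\mathcal{I}$ with $A\preccurlyeq g(x)$ for all $x\in X$. *)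

(* Defs.v *)
From HB Require Import structures.
From mathcomp Require Import all_boot all_order all_algebra.
From mathcomp Require Import all_classical all_reals all_analysis.

Set Implicit Arguments.
Unset Strict Implicit.
Unset Printing Implicit Defensive.

Import Order.TTheory GRing.Theory Num.Theory.

Local Open Scope classical_set_scope.
Local Open Scope ring_scope.

(* A closed bounded interval [a, b] is determined by its endpoints; degenerate
   intervals are allowed and the empty set is excluded, so the pair of
   endpoints represents it faithfully. *)
Record cinterval (R : realType) := CInterval {
  lower : R;
  upper : R;
  lower_le_upper : lower <= upper
}.

Definition cinterval_le (R : realType) (A B : cinterval R) : bool :=
  (lower A <= lower B) && (upper A <= upper B).

Notation "A '\preceq' B" := (cinterval_le A B)
  (at level 70, no associativity).

Definition cinterval_add (R : realType) (A B : cinterval R) : cinterval R :=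
  CInterval (lerD (lower_le_upper A) (lower_le_upper B)).

Notation "A '\iplus' B" := (cinterval_add A B)
  (at level 50, left associativity).

Definition cinterval_point (R : realType) (r : R) : cinterval R :=
  CInterval (lexx r).

Definition interval_lsc (R : realType) (X : metricType R)
    (g : X -> cinterval R) : Prop :=
  forall A : cinterval R, closed [set x | g x \preceq A].

Definition interval_lower_bounded (R : realType) (X : Type)
    (g : X -> cinterval R) : Prop :=
  exists A : cinterval R, forall x : X, A \preceq g x.

(* Completeness is a predicate because the structure [completeType] is
   pointed, whereas a [metricType] need not be. *)
Definition complete_metric (R : realType) (X : metricType R) : Prop :=
  forall u : nat -> X, cauchy (u @ \oo) -> exists l : X, u @ \oo --> l.

(* Main.v *)
Require Import Defs.
From HB Require Import structures.
From mathcomp Require Import all_boot all_order all_algebra.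
From mathcomp Require Import all_classical all_reals all_analysis.
From mathcomp Require Import lra.

(** The proof has three layers.

    Reduction to scalars.  Against a degenerate interval [[t, t]] the relation
    [A \preceq [t, t]] only says [upper A <= t], since [lower A <= upper A].
    Hence the hypotheses on [f] make [h x y := upper (f x y)] a real bifunction
    that is lower semicontinuous and bounded below in [y] and satisfies
    [h x z <= h x y + h y z], and the second conclusion speaks of [h] alone.
    The lower endpoints enter only the first conclusion, where the triangle
    inequality at [x0, x0, x0] gives [0 <= lower (f x0 x0)] and therefore
    [f x0 xbar \preceq f x0 x0] as soon as [h x0 xbar <= 0].

    Ekeland's principle for [h].  The relation
    [y = x \/ h x y + eps * mdist x y <= 0] is a preorder, by the triangle
    inequalities for [h] and for the distance, and its successor sets are
    closed.  A point [y] whose value [h x y] is within [delta] of the infimum of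
    [h x] over the successors of [x] has [h y z >= - delta] for every successor
    [z], so that [eps * mdist y z <= delta]: successor sets can be made
    arbitrarily small.  A minimal point of the preorder below [x0] is then the
    required point ([ekeland_bifunction]).

    Existence of a minimal point ([closed_preorder_minimal]).  Descending along
    points with ever smaller successor sets produces nested closed sets with
    diameters tending to zero; by completeness they meet in one point, whose
    successors lie in all of them. *)

Import Order.TTheory GRing.Theory Num.Theory.

Local Open Scope classical_set_scope.
Local Open Scope ring_scope.

Lemma closed_mdist_le (R : realType) (X : metricType R) (x : X) (t : R) :
  closed [set y | mdist x y <= t].
Proof.
move=> y cl_y /=; rewrite leNgt; apply/negP => t_lt.
have r_gt0 : 0 < mdist x y - t by rewrite subr_gt0.
have [z []] := cl_y _ (nbhsx_ballx y _ r_gt0).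
rewrite ballEmdist /= (metric_sym y z) => xz yz.
by have := metric_triangle x z y; lra.
Qed.

(** Lower semicontinuity is stable under addition; the point of the proof is
    that [g y + k y <= 0] fails exactly when some level [t] satisfies
    [- t < g y] and [t < k y], which exhibits the set as an intersection of
    unions of two sublevel sets. *)
Lemma closed_add_le0 (R : realType) (T : topologicalType) (g k : T -> R) :
  (forall t, closed [set y | g y <= t]) ->
  (forall t, closed [set y | k y <= t]) ->
  closed [set y | g y + k y <= 0].
Proof.
move=> g_lsc k_lsc.
rewrite (_ : [set y | _] =
    \bigcap_(t in [set: R]) ([set y | g y <= - t] `|` [set y | k y <= t])).
  by apply: closed_bigI => t _; apply: closedU.
apply/seteqP; split => [y /= gk t _ /=|y /= gk].
  by case: (lerP (k y) t) => kt; [right|left; lra].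
rewrite leNgt; apply/negP => gk_gt0.
(* the midpoint of the interval between [- g y] and [k y] *)
by case: (gk ((k y - g y) / 2) I) => /= ?; lra.
Qed.

(** The set-valued form of Ekeland's principle: [S x] is the set of successors
    of [x] for a preorder, and [S_small] says that every point has successors
    whose own successors are all close to them. *)
Lemma closed_preorder_minimal (R : realType) (X : metricType R)
    (complete_X : complete_metric X) (S : X -> set X)
    (S_refl : forall x, S x x)
    (S_trans : forall x y z, S x y -> S y z -> S x z)
    (S_closed : forall x, closed (S x))
    (S_small : forall x (e : R), 0 < e ->
      exists y, S x y /\ forall z, S y z -> mdist y z < e)
    (x0 : X) :
  exists xbar, S x0 xbar /\ forall x, S xbar x -> x = xbar.
Proof.
have step_ex (p : X * nat) : exists y, S p.1 y /\
    forall z, S y z -> mdist y z < p.2.+1%:R^-1.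
  by apply: S_small; rewrite invr_gt0 ltr0n.
have [next nextP] := choice step_ex.
pose u := fix u n := if n is m.+1 then next (u m, m) else x0.
have u_desc n k : S (u n) (u (n + k)%N).
  elim: k => [|k IHk]; first by rewrite addn0.
  rewrite addnS /=; apply: S_trans IHk _.
  by have [] := nextP (u (n + k)%N, (n + k)%N).
have u_small (e : R) : 0 < e ->
    exists n, forall z, S (u n) z -> mdist (u n) z < e.
  move=> e_gt0.
  have [N _ /(_ N (leqnn N)) N_lt] := near_infty_natSinv_lt (PosNum e_gt0).
  exists N.+1 => z Sz; apply: lt_trans N_lt.
  by have [_ /(_ z Sz)] := nextP (u N, N).
have tail n : \forall m \near \oo, S (u n) (u m).
  by exists n => // m /= n_le_m; rewrite -(subnKC n_le_m).
have u_cauchy : cauchy (u @ \oo).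
  apply: cauchy_exP => e /u_small [n near_un]; exists (u n).
  have [N _ NP] := tail n; exists N => // m /NP /near_un.
  by rewrite /= ballEmdist.
have [xbar u_to_xbar] := complete_X u u_cauchy.
have S_xbar n : S (u n) xbar.
  exact: (closed_cvg (S (u n)) (S_closed (u n)) (tail n) _ u_to_xbar).
exists xbar; split=> [|x Sx]; first exact: (S_xbar 0%N).
apply: contrapT => /eqP; rewrite -mdist_gt0 => d_gt0.
have [n near_un] :
    exists n, forall z, S (u n) z -> mdist (u n) z < mdist x xbar / 2.
  by apply: u_small; lra.
have := near_un _ (S_xbar n); have := near_un _ (S_trans _ _ _ (S_xbar n) Sx).
by have := metric_triangle x (u n) xbar; rewrite (metric_sym x (u n)); lra.
Qed.

(** Ekeland's variational principle for bifunctions. The alternative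
    [xbar = x0] cannot be absorbed into the inequality, because [h x0 x0] may be
    positive. *)
Lemma ekeland_bifunction (R : realType) (X : metricType R)
    (complete_X : complete_metric X) (h : X -> X -> R)
    (h_lsc : forall x t, closed [set y | h x y <= t])
    (h_bounded : forall x, exists m, forall y, m <= h x y)
    (h_triangle : forall x y z, h x z <= h x y + h y z)
    (eps : R) (eps_gt0 : 0 < eps) (x0 : X) :
  exists xbar : X,
    (xbar = x0 \/ h x0 xbar + eps * mdist x0 xbar <= 0) /\
    forall x, x <> xbar -> 0 < h xbar x + eps * mdist xbar x.
Proof.
pose S x := [set x] `|` [set y | h x y + eps * mdist x y <= 0].
have S_refl x : S x x by left.
have S_trans x y z : S x y -> S y z -> S x z.
  move=> [->//|/= xy] [->|/= yz]; [by right|right => /=].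
  have := ler_wpM2l (ltW eps_gt0) (metric_triangle x y z).
  by have := h_triangle x y z; rewrite mulrDr; lra.
have S_closed x : closed (S x).
  apply: closedU.
    have X_T1 := hausdorff_accessible (@metric_hausdorff R X).
    exact: accessible_closed_set1 X_T1 _.
  apply: closed_add_le0 => // t.
  rewrite (_ : [set y | _] = [set y | mdist x y <= t / eps]).
    exact: closed_mdist_le.
  by apply/seteqP; split=> y /=; rewrite ler_pdivlMr // mulrC.
have S_small x (e : R) : 0 < e ->
    exists y, S x y /\ forall z, S y z -> mdist y z < e.
  move=> e_gt0; have delta_gt0 : 0 < eps * e by rewrite mulr_gt0.
  have inf_hS : has_inf (h x @` S x).
    split; first by exists (h x x), x.
    by have [m m_le] := h_bounded x; exists m => _ [y _ <-].
  have [_ [y Sxy <-] hxy_lt] := inf_adherent delta_gt0 inf_hS.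
  exists y; split=> // z Syz.
  have hxz_ge : inf (h x @` S x) <= h x z.
    by apply: ge_inf; [case: inf_hS|exists z => //; exact: S_trans Syz].
  case: Syz => [->|/= yz]; first by rewrite mdistxx.
  rewrite -(ltr_pM2l eps_gt0).
  by have := h_triangle x y z; lra.
have [xbar [Sxbar xbar_min]] :=
  closed_preorder_minimal _ _ complete_X S S_refl S_trans S_closed S_small x0.
exists xbar; split=> // x x_neq; rewrite ltNge; apply/negP => hx.
by apply: x_neq; apply: xbar_min; right.
Qed.

(** This is what reduces the interval problem to the upper endpoints. *)
Lemma cinterval_le_point (R : realType) (A : cinterval R) (t : R) :
  (A \preceq cinterval_point t) = (upper A <= t).
Proof.
rewrite /cinterval_le /=; case: (lerP (upper A) t); rewrite ?andbF ?andbT //.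
exact: le_trans (lower_le_upper A).
Qed.

Theorem theorem3p4 (R : realType) (X : metricType R)
    (complete_X : complete_metric X)
    (f : X -> X -> cinterval R)
    (f_lsc_bounded : forall x : X,
      interval_lsc (f x) /\ interval_lower_bounded (f x))
    (f_triangle : forall x y z : X, f x z \preceq f x y \iplus f y z)
    (eps : R) (eps_gt0 : 0 < eps) (x0 : X) :
  exists xbar : X,
    f x0 xbar \preceq f x0 x0 /\
    (forall x : X, x <> xbar ->
      ~ (f xbar x \iplus cinterval_point (eps * mdist x xbar)
           \preceq cinterval_point 0)).
Proof.
pose h x y := upper (f x y).
have h_lsc x t : closed [set y | h x y <= t].
  rewrite (_ : [set y | _] = [set y | f x y \preceq cinterval_point t]).
    exact: (f_lsc_bounded x).1.
  by apply/seteqP; split=> y /=; rewrite cinterval_le_point.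
have h_bounded x : exists m, forall y, m <= h x y.
  have [_ [A A_le]] := f_lsc_bounded x.
  by exists (upper A) => y; case/andP: (A_le y).
have h_triangle x y z : h x z <= h x y + h y z by case/andP: (f_triangle x y z).
have [xbar [xbar_x0 xbar_min]] :=
  ekeland_bifunction _ _ complete_X h h_lsc h_bounded h_triangle eps eps_gt0 x0.
exists xbar; split=> [|x /xbar_min]; last first.
  by rewrite cinterval_le_point /= metric_sym ltNge => /negP.
case: xbar_x0 => [->|hx]; first by rewrite /cinterval_le !lexx.
have lower_ge0 : 0 <= lower (f x0 x0).
  by have /andP[/= ? _] := f_triangle x0 x0 x0; lra.
have upper_le0 : upper (f x0 xbar) <= 0.
  have := mulr_ge0 (ltW eps_gt0) (mdist_ge0 x0 xbar).
  by move: hx; rewrite /h; lra.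
have := lower_le_upper (f x0 xbar); have := lower_le_upper (f x0 x0).
by rewrite /cinterval_le => ? ?; apply/andP; split; lra.
Qed.
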